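(* Let $G=G_1\cup G_2$ be a clique-sum of two graphs $G_1$ and $G_2$. Then: (1) For any $t\ge1$, $J(G)^t=J(G_1)^t\cap J(G_2)^t$. (2) For any $s\ge1$, $J(G)^{(s)}=J(G_1)^{(s)}\cap J(G_2)^{(s)}$. (3) $\rho(J(G))=\max\{\rho(J(G_1)),\rho(J(G_2))\}$. (4) $\rho_a(J(G))=\max\{\rho_a(J(G_1)),\rho_a(J(G_2))\}$.
   Context: All graphs are finite and simple, with no isolated vertices. If $G_1,G_2$ are graphs such that $G_1\cap G_2=K_r$ is a complete graph (on $r\ge1$ vertices), with $G_1\neq K_r$ and $G_2\ne K_r$, then $G_1\cup G_2$ is called the clique-sum of $G_1$ and $G_2$ along $K_r$ (here unions and intersections are taken on vertex sets and edge sets). The cover ideal $J(G)$ of a graph $G$, over a field $\mathbb{K}$, is the ideal of the polynomial ring in the variables $V(G)$ generated by the monomials $\prod_{x\in\Gamma}x$, $\Gamma$ a vertex cover of $G$; equivalently $J(G)=\bigcap_{\{x,y\}\in E(G)}(x,y)$. In (1) and (2), $J(G_1)$ and $J(G_2)$ are viewed as (extended to) ideals of $\mathbb{K}[x : x\in V(G)]$. For an ideal $I$ in a Noetherian ring $R$, $I^{(s)}=\bigcap_{P\in\mathrm{Ass}(I)}(I^sR_P\cap R)$ is the $s$-th symbolic power. The resurgence and asymptotic resurgence are $\rho(I)=\sup\{s/t : s,t\in\mathbb{N},\ I^{(s)}\not\subset I^t\}$ and $\rho_a(I)=\sup\{s/t : s,t\in\mathbb{N},\ I^{(sr)}\not\subset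 I^{tr}\text{ for all } r\gg0\}$, where $\mathbb{N}$ denotes the positive integers. *)

(* Defs.v *)
(* [mpoly] must be imported before the analysis files: their notations clash in
   the other order. *)
From mathcomp Require Import mpoly.
From mathcomp Require Import all_boot all_order all_algebra.
From mathcomp Require Import all_classical all_reals all_analysis.

Set Implicit Arguments.
Unset Strict Implicit.
Unset Printing Implicit Defensive.

Import Order.TTheory GRing.Theory Num.Theory.

Local Open Scope classical_set_scope.
Local Open Scope ring_scope.

(** Finite simple graphs.  [T] is an ambient finite type of vertex names, so
    that unions and intersections of graphs can be formed. *)

Record graph (T : finType) := Graph {
  verts : {set T};
  edges : {set {set T}};
  edgesP : [forall e in edges, (#|e| == 2) && (e \subset verts)] }.

Section Graphs.
Variable T : finType.
Implicit Types G H : graph T.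

Definition no_isolated G : Prop :=
  forall x, x \in verts G -> exists2 e, e \in edges G & x \in e.

Fact gunion_subproof G H :
  [forall e in edges G :|: edges H,
     (#|e| == 2) && (e \subset verts G :|: verts H)].
Proof.
apply/forall_inP => e /setUP[] /(forall_inP (edgesP _))/andP[-> /= eV].
- exact: fintype.subset_trans eV (finset.subsetUl _ _).
- exact: fintype.subset_trans eV (finset.subsetUr _ _).
Qed.
Definition gunion G H : graph T := Graph (gunion_subproof G H).

Fact ginter_subproof G H :
  [forall e in edges G :&: edges H,
     (#|e| == 2) && (e \subset verts G :&: verts H)].
Proof.
apply/forall_inP => e /setIP[] /(forall_inP (edgesP _))/andP[-> /= subG].
by move=> /(forall_inP (edgesP _))/andP[_ subH]; rewrite finset.subsetI subG.
Qed.
Definition ginter G H : graph T := Graph (ginter_subproof G H).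

Fact complete_subproof (S : {set T}) :
  [forall e in [set e : {set T} | (e \subset S) & #|e| == 2]%SET,
     (#|e| == 2) && (e \subset S)].
Proof. by apply/forall_inP => e; rewrite finset.inE andbC. Qed.
Definition complete (S : {set T}) : graph T := Graph (complete_subproof S).

(** [gunion G1 G2] is the clique-sum of [G1] and [G2] along the clique on [S]. *)
Definition clique_sum G1 G2 : Prop :=
  exists S : {set T},
    [/\ (1 <= #|S|)%N, ginter G1 G2 = complete S,
        G1 <> complete S & G2 <> complete S].

Definition vertex_cover G (C : {set T}) : Prop :=
  C \subset verts G /\ (forall e, e \in edges G -> exists2 x, x \in e & x \in C).

End Graphs.

Section Ideals.
Variable A : idomainType.
Implicit Types (I P : set A).

(** Finite sums of products of an element of [C] by an element of [S]; in
    particular [combs setT S] is the ideal generated by [S]. *)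
Definition combs (B : nzRingType) (C S : set B) : set B :=
  [set y | exists n (c s : 'I_n -> B),
     [/\ forall i, C (c i), forall i, S (s i) & y = \sum_(i < n) c i * s i]].

Definition ideal_gen (B : nzRingType) (S : set B) : set B := combs setT S.

Definition ideal_pow I (t : nat) : set A :=
  ideal_gen [set f | exists g : 'I_t -> A,
                       (forall i, I (g i)) /\ f = \prod_(i < t) g i].

Definition prime_ideal P : Prop :=
  idealr_closed [in P] /\ prime_idealr_closed [in P].

(** The primes of the form [(I : f)], i.e. the associated primes of [A/I]. *)
Definition assoc_primes I : set (set A) :=
  [set P | prime_ideal P /\ exists f : A, P = [set g | I (g * f)]].

(** The localization [A_P], as a subring of the fraction field of [A]. *)
Definition localization P : set {fraction A} :=
  [set x | exists a b : A, ~ P b /\ x = tofrac a / tofrac b].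

(** The ideal [I A_P] of [A_P]. *)
Definition local_ext I P : set {fraction A} :=
  combs (localization P) (@tofrac A @` I).

Definition symb_pow I (s : nat) : set A :=
  \bigcap_(P in assoc_primes I) (@tofrac A @^-1` local_ext (ideal_pow I s) P).

Definition resurgence (R : realType) I : \bar R :=
  ereal_sup [set x | exists s t : nat,
    [/\ (0 < s)%N, (0 < t)%N, x = (s%:R / t%:R)%:E
      & ~ (symb_pow I s `<=` ideal_pow I t)]].

Definition asymp_resurgence (R : realType) I : \bar R :=
  ereal_sup [set x | exists s t : nat,
    [/\ (0 < s)%N, (0 < t)%N, x = (s%:R / t%:R)%:E
      & \forall r \near \oo,
          ~ (symb_pow I (s * r)%N `<=` ideal_pow I (t * r)%N)]].

End Ideals.

Section CoverIdeals.
Variables (K : fieldType) (T : finType).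
Implicit Types (V W : {set T}) (G : graph T).

(** The polynomial ring [K[x : x in V]]: the variable of index [i] stands for
    the vertex [enum_val i] of [V]. *)
Local Notation vpoly V := {mpoly K[#|V|]}.

Definition vvar V (i : 'I_#|V|) : vpoly V := 'X_i.

Definition cover_ideal G : set (vpoly (verts G)) :=
  ideal_gen [set f | exists C : {set T}, vertex_cover G C /\
    f = \prod_(i < #|verts G| | enum_val i \in C) vvar i].

(** The inclusion [K[x : x in V] -> K[x : x in W]] for [V \subset W]. *)
Definition vincl V W (VW : V \subset W) (f : vpoly V) : vpoly W :=
  f \mPo
    [tuple vvar (enum_rank_in (fintype.subsetP VW _ (enum_valP i)) (enum_val i))
      | i < #|V|].

Definition ideal_ext V W (VW : V \subset W) (I : set (vpoly V)) :
  set (vpoly W) := ideal_gen (vincl VW @` I).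

End CoverIdeals.

Arguments cover_ideal K {T} G _.

(* Main.v *)
Require Import Defs.
From mathcomp Require Import mpoly.
From mathcomp Require Import all_boot all_order all_algebra all_fingroup.
From mathcomp Require Import all_classical all_reals all_analysis.
From mathcomp Require Import zify ring.

Set Implicit Arguments.
Unset Strict Implicit.
Unset Printing Implicit Defensive.

Import Order.TTheory GRing.Theory Num.Theory.

(** All the ideals involved are monomial, so everything is decided by exponent
    vectors [a : T -> nat].  Such an [a] lies in the [t]-th power of the cover
    ideal when it dominates a sum of [t] vertex covers ([pow_exponent]), and in
    the [s]-th symbolic power when [a x + a y >= s] for every edge
    ([symb_exponent]); the latter is the translation
    [symb_pow_pow_ideal] of the definition by localization.  Since the second
    condition is imposed edge by edge, the formula for symbolic powers is
    immediate.

    The formula for ordinary powers rests on a reformulation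
    ([pow_exponent_colouring]): [a] dominates [t] covers if and only if each
    vertex [x] can be given a set of exactly [t - a x] colours out of [t]
    (the covers avoiding [x]) so that adjacent vertices get disjoint sets.
    On the common clique the colour sets are pairwise disjoint and their
    sizes depend only on [a], so a permutation of the colours makes two such
    colourings, one of each graph, agree on the clique, and they glue
    ([pow_exponent_glue]).

    An exponent vector of [G1] extends to [G] with value [s] at the new
    vertices without leaving the [s]-th symbolic power.  Together with the
    formula for powers this shows that the containment of the [s]-th symbolic
    power in the [t]-th power fails for [G] exactly when it fails for [G1] or
    for [G2] ([noncontained_glue]), which gives the resurgence.

    For the asymptotic resurgence this is not enough: failure for all large
    [r] in [G] only gives failure for infinitely many [r] in one of the
    [Gi]. The missing fact is [noncontained_asymp]: failure at [(s r, t r)]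
    for infinitely many [r] forces failure at [(s' k, t' k)] for all large
    [k] whenever [s'/t' < s/t]. It holds because powers of a cover ideal are
    close to their integral closures: if [N a] dominates [M] covers then [a]
    dominates at least [M / N - c] covers, [c] being a constant
    ([pow_exponent_scale]). *)

(** * Exponents of powers and of symbolic powers *)

Section Exponents.
Local Open Scope nat_scope.
Local Open Scope set_scope.
Variable T : finType.
Implicit Types (E : {set {set T}}) (C V : {set T}) (a b : T -> nat).

Definition covers E C : Prop :=
  forall e, e \in E -> exists2 x, x \in e & x \in C.

(** The covers [C k] are arbitrary subsets of [T]: by [pow_exponent_le],
    intersecting them with a set that contains all edges changes nothing, so the
    predicate is independent of the ambient set of variables. *)
Definition pow_exponent E t a : Prop :=
  exists C : 'I_t -> {set T},
    (forall k, covers E (C k)) /\ forall x, \sum_k (x \in C k) <= a x.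

Definition symb_exponent E s a : Prop :=
  forall e, e \in E -> s <= \sum_(x in e) a x.

Lemma pow_exponent_le E V t a b :
    (forall e, e \in E -> e \subset V) -> (forall x, x \in V -> a x <= b x) ->
  pow_exponent E t a -> pow_exponent E t b.
Proof.
move=> EV ab [C [covC Ca]]; exists (fun k => C k :&: V); split=> [k e eE|x].
  have [x xe xC] := covC k e eE.
  by exists x => //; rewrite finset.inE xC (fintype.subsetP (EV e eE)).
case xV: (x \in V); last first.
  by rewrite big1 // => k _; rewrite finset.inE xV andbF.
apply: leq_trans (ab x xV); apply: leq_trans (Ca x).
by apply: leq_sum => k _; rewrite finset.inE xV andbT.
Qed.

Lemma pow_exponent_mono E t a b :
  (forall x, a x <= b x) -> pow_exponent E t a -> pow_exponent E t b.
Proof. by move=> ab; apply: (@pow_exponent_le E [set: T]). Qed.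

Lemma symb_exponent_le E V s a b :
    (forall e, e \in E -> e \subset V) -> (forall x, x \in V -> a x <= b x) ->
  symb_exponent E s a -> symb_exponent E s b.
Proof.
move=> EV ab sa e eE; apply: leq_trans (sa e eE) _.
by apply: leq_sum => x xe; apply: ab; apply: (fintype.subsetP (EV e eE)).
Qed.

Lemma pow_symb_exponent E t a : pow_exponent E t a -> symb_exponent E t a.
Proof.
move=> [C [covC Ca]] e eE.
apply: (@leq_trans (\sum_(x in e) \sum_k (x \in C k))); last exact: leq_sum.
rewrite exchange_big /= -[X in X <= _]card_ord -sum1_card.
apply: leq_sum => k _.
by have [x xe xC] := covC k e eE; rewrite (bigD1 x) //= xC.
Qed.

Lemma symb_pow_exponent1 E a : symb_exponent E 1 a -> pow_exponent E 1 a.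
Proof.
move=> sa; exists (fun=> [set x | 0 < a x]); split=> [k e eE|x].
  have := sa e eE; rewrite lt0n sum_nat_eq0 => /forall_inPn[x xe ax].
  by exists x; rewrite // finset.inE lt0n.
by rewrite big_ord1 finset.inE; case: (a x).
Qed.

Lemma pow_exponent0 E a : pow_exponent E 0 a.
Proof. by exists (fun=> finset.set0); split=> [[]//|x]; rewrite big_ord0. Qed.

Lemma pow_exponentD E t u a b :
  pow_exponent E t a -> pow_exponent E u b ->
  pow_exponent E (t + u) (fun x => a x + b x).
Proof.
move=> [C [covC Ca]] [D [covD Db]].
exists (fun k => match fintype.split k with inl i => C i | inr j => D j end).
split=> [k|x]; first by case: (fintype.split k).
rewrite big_split_ord /=; apply: leq_add.
  rewrite (eq_bigr (fun k => (x \in C k) : nat)) // => i _.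
  by rewrite (unsplitK (inl _ i)).
rewrite (eq_bigr (fun k => (x \in D k) : nat)) // => i _.
by rewrite (unsplitK (inr _ i)).
Qed.

(** The complement of a vertex is always a cover.  When only the edge
    [e = {x, y}] is a constraint, use [min s (a x)] times the complement of [y]
    and otherwise the complement of [x]. *)
Lemma pow_exponent_edge E s a (e : {set T}) :
    (forall e', e' \in E -> #|e'| = 2) -> #|e| = 2 ->
    s <= \sum_(x in e) a x -> (forall x, x \notin e -> s <= a x) ->
  pow_exponent E s a.
Proof.
move=> E2 /eqP/cards2P[x [y [xy ->]]] {e}.
rewrite big_setU1 ?inE //= big_set1 => sxy sout.
pose C (k : 'I_s) := if k < a x then [set~ y] else [set~ x].
have sE z : \sum_(k < s) (z \in C k) <= a z.
  case: (boolP (z \in [set x; y])) => [|zxy]; last first.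
    apply: leq_trans (sout z zxy); rewrite -[X in _ <= X]card_ord -sum1_card.
    by apply: leq_sum => k _; case: (_ \in _).
  have cE (P : pred nat) : \sum_(k < s) P k = \sum_(0 <= k < s) P k.
    by rewrite big_mkord.
  have cnt u : \sum_(0 <= k < u) (k < a x) = minn u (a x).
    elim: u => [|u IH]; first by rewrite big_geq // min0n.
    by rewrite big_nat_recr //= IH; case: ltnP => ?; lia.
  have cnt' u : \sum_(0 <= k < u) (a x <= k) = u - a x.
    elim: u => [|u IH]; first by rewrite big_geq.
    by rewrite big_nat_recr //= IH; case: leqP => ?; lia.
  rewrite !inE => /orP[]/eqP->.
    rewrite (eq_bigr (fun k : 'I_s => (k < a x) : nat)).
      by rewrite (cE (fun k => k < a x)) cnt geq_minr.
    by move=> k _; rewrite /C; case: ifP; rewrite !inE ?xy ?eqxx.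
  rewrite (eq_bigr (fun k : 'I_s => (a x <= k) : nat)).
    by rewrite (cE (fun k => a x <= k)) cnt'; lia.
  move=> k _; rewrite /C; case: leqP => _; rewrite !inE ?eqxx //.
  by rewrite eq_sym xy.
exists C; split=> // k e' e'E.
have /eqP/cards2P[u [v [uv ->]]] := E2 e' e'E.
pose z := if k < a x then y else x.
have -> : C k = [set~ z] by rewrite /C /z; case: ifP.
have [uz|uz] := eqVneq u z; last by exists u; rewrite !inE ?eqxx.
by exists v; rewrite !inE ?eqxx ?orbT // -uz eq_sym.
Qed.

(** * Gluing multicolourings along a clique *)

Lemma sum_nat_bool (I : finType) (P : pred I) :
  \sum_i (P i : nat) = #|[set i | P i]|.
Proof.
rewrite cardsE -sum1_card [RHS]big_mkcond; apply: eq_bigr => i _.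
by rewrite unfold_in; case: (P i).
Qed.

(** [M x] is the set of covers that avoid [x].  Covers may be enlarged, which
    makes the number of those avoiding [x] exactly [t - a x] (truncated), hence
    a function of [a] alone: this is what allows gluing. *)
Lemma pow_exponent_colouring E t a :
  pow_exponent E t a <->
  exists M : T -> {set 'I_t},
    (forall x, #|M x| = t - a x) /\
    forall e, e \in E -> forall k, exists2 x, x \in e & k \notin M x.
Proof.
split=> [[C [covC Ca]]|[M [cM MP]]].
  pose A x := [set k | x \notin C k].
  have cA x : t - a x <= #|A x|.
    have := Ca x; rewrite sum_nat_bool -[t in t - _]card_ord.
    rewrite -(cardsC [set k | x \in C k]).
    by rewrite (_ : ~: _ = A x); [lia|apply/setP => k; rewrite !inE].
  exists (fun x => [set k in take (t - a x) (enum (A x))]); split=> [x|e eE k].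
    rewrite cardsE (card_uniqP _) ?take_uniq ?enum_uniq // size_take -cardE.
    by have := cA x; case: ltngtP.
  have [x xe xC] := covC k e eE; exists x => //; rewrite inE.
  by apply/negP => /mem_take; rewrite mem_enum inE xC.
exists (fun k => [set x | k \notin M x]); split=> [k e eE|x].
  by have [x xe kM] := MP e eE k; exists x; rewrite // inE.
have := cardsC (M x); rewrite card_ord cM.
rewrite (_ : \sum_k _ = #|~: M x|); first by lia.
by rewrite sum_nat_bool; apply: eq_card => k; rewrite !inE.
Qed.

(** Equal fibre sizes mean that the lists of values of [c] and of [d] are
    rearrangements of each other. *)
Lemma eq_card_perm (I : finType) t (c d : 'I_t -> I) :
  (forall i, #|[set k | c k == i]| = #|[set k | d k == i]|) ->
  exists p : 'S_t, forall k, c k = d (p k).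
Proof.
move=> cd; have : perm_eq [tuple c k | k < t] [tuple d k | k < t].
  apply/allP => i _ /=; rewrite !count_map; apply/eqP.
  by have := cd i; rewrite !cardsE !cardE /enum_mem !size_filter -!enumT.
move=> /tuple_permP[p pE]; exists p => k.
have := congr1 (fun s => nth (c k) s k) pE.
by rewrite -!tnth_nth !tnth_mktuple.
Qed.

(** Each colour belongs to at most one of the disjoint sets; mapping it to the
    index of that set, or to [None], gives two functions to compare with
    [eq_card_perm]. *)
Lemma disjoint_families_perm t (S : {set T}) (M N : T -> {set 'I_t}) :
    (forall x, x \in S -> #|M x| = #|N x|) ->
    (forall x y k, x \in S -> y \in S -> k \in M x -> k \in M y -> x = y) ->
    (forall x y k, x \in S -> y \in S -> k \in N x -> k \in N y -> x = y) ->
  exists p : 'S_t, forall x k, x \in S -> (k \in M x) = (p k \in N x).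
Proof.
move=> MN dM dN.
pose dis (L : T -> {set 'I_t}) :=
  forall x y k, x \in S -> y \in S -> k \in L x -> k \in L y -> x = y.
pose c (L : T -> {set 'I_t}) k := [pick x in S | k \in L x].
have cE (L : T -> {set 'I_t}) x k :
    dis L -> x \in S -> (c L k == Some x) = (k \in L x).
  move=> dL xS; rewrite /c; case: pickP => [y /andP[yS kLy]|/(_ x)].
    apply/eqP/idP => [[<-]//|kLx]; congr Some; exact: dL yS xS kLy kLx.
  by rewrite xS /= => kLx; rewrite kLx.
have cS L x k : c L k == Some x -> x \in S.
  by rewrite /c; case: pickP => // y /andP[yS _] /eqP[<-].
have eqS x : #|[set k | c M k == Some x]| = #|[set k | c N k == Some x]|.
  have [xS|xS] := boolP (x \in S).
    suff fib (L : T -> {set 'I_t}) : dis L -> [set k | c L k == Some x] = L x.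
      by rewrite (fib M) ?(fib N) ?MN.
    move=> dL.
    by apply/setP => k; rewrite inE cE.
  suff fib L : [set k | c L k == Some x] = finset.set0 by rewrite !fib.
  by apply/setP => k; rewrite !inE; apply: contraNF xS; apply: cS.
have [|p pE] := @eq_card_perm (option T) t (c M) (c N).
  (* the fibres over None agree because all fibre sizes add up to t *)
  have tot L : t = \sum_o #|[set k | c L k == o]|.
    rewrite -[LHS]card_ord -sum1_card (partition_big (c L) xpredT) //=.
    apply: eq_bigr => o _; rewrite -sum1_card.
    by apply: eq_bigl => k; rewrite inE.
  case=> [x|]; first exact: eqS.
  have := tot M.
  rewrite [in LHS](tot N) (bigD1 None) //= [in RHS](bigD1 None) //=.
  rewrite [in X in _ = _ + X](eq_bigr (fun o => #|[set k | c N k == o]|)).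
    by move=> /addIn.
  by case.
by exists p => x k xS; rewrite -!cE // pE.
Qed.

(** A colouring of the first graph and one of the second have, at each vertex of
    the clique [S], the same number of colours; after a permutation of the
    colours of the second they agree on [S]. *)
Lemma pow_exponent_glue (V1 V2 S : {set T}) E1 E2 t a :
    (forall e, e \in E1 -> e \subset V1) ->
    (forall e, e \in E2 -> e \subset V2) ->
    V1 :&: V2 = S ->
    (forall x y, x \in S -> y \in S -> x != y -> [set x; y] \in E1 :&: E2) ->
  pow_exponent (E1 :|: E2) t a <-> pow_exponent E1 t a /\ pow_exponent E2 t a.
Proof.
move=> EV1 EV2 VS SE; split=> [[C [covC Ca]]|].
  by split; exists C; split=> // k e eE; apply: covC; rewrite inE eE ?orbT.
move=> [/pow_exponent_colouring[M [cM MP]] /pow_exponent_colouring[N [cN NP]]].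
have dis (L : T -> {set 'I_t}) x y k :
    (forall e, e \in E1 :&: E2 ->
       forall k, exists2 x, x \in e & k \notin L x) ->
    x \in S -> y \in S -> k \in L x -> k \in L y -> x = y.
  move=> LP xS yS kx ky; apply/eqP; apply: contraT => xy.
  have [z] := LP _ (SE x y xS yS xy) k.
  by rewrite !inE => /orP[]/eqP->; rewrite ?kx ?ky.
have [|||p pE] := @disjoint_families_perm t S M N.
- by move=> x _; rewrite cM cN.
- by move=> x y k; apply: dis => e /setIP[eE _]; apply: MP.
- by move=> x y k; apply: dis => e /setIP[_ eE]; apply: NP.
apply/pow_exponent_colouring.
exists (fun x => if x \in V1 then M x else p @^-1: N x); split=> [x|e].
  case: ifP => // _.
  have -> : p @^-1: N x = (p^-1)%g @: N x.
    apply/setP => k; rewrite inE; apply/idP/imsetP => [kN|[j jN ->]].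
      by exists (p k); rewrite // permK.
    by rewrite permKV.
  by rewrite card_imset //; apply: perm_inj.
move=> /setUP[eE|eE] k.
  have [x xe kM] := MP e eE k; exists x => //.
  by rewrite (fintype.subsetP (EV1 e eE)).
have [x xe kN] := NP e eE (p k); exists x => //.
case: ifP => xV1; last by rewrite inE.
by rewrite pE // -VS inE xV1 (fintype.subsetP (EV2 e eE)).
Qed.

(** * Failure of containment and its persistence *)

(** Prescribing how often each cover is used, in place of a list of covers. *)
Lemma pow_exponent_mult E t a (q : {set T} -> nat) :
    (forall C, 0 < q C -> covers E C) -> t <= \sum_C q C ->
    (forall x, \sum_(C : {set T} | x \in C) q C <= a x) ->
  pow_exponent E t a.
Proof.
move=> qcov tq qa.
pose s := flatten [seq nseq (q C) C | C <- enum {set T}].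
have ss : size s = \sum_C q C.
  rewrite size_flatten /shape -map_comp sumnE big_map enumT.
  by apply: eq_bigr => C _; rewrite /= size_nseq.
pose at_ x := fun C : {set T} => x \in C.
have cs x : count (at_ x) s = \sum_(C : {set T} | x \in C) q C.
  rewrite count_flatten -map_comp sumnE big_map enumT [RHS]big_mkcond.
  apply: eq_bigr => C _; rewrite /= count_nseq /at_.
  by case: (_ \in _); rewrite ?mul1n ?mul0n.
exists (fun k : 'I_t => nth finset.set0 s k); split=> [k|x].
  have : nth finset.set0 s k \in s.
    by rewrite mem_nth // ss; apply: leq_trans tq.
  move=> /flattenP[u /mapP[C _ ->]] /nseqP[-> qC]; exact: qcov.
apply: leq_trans (qa x); rewrite -cs.
have -> : \sum_(k < t) (x \in nth finset.set0 s k) = count (at_ x) (take t s).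
  rewrite -sum1_count (big_nth finset.set0) size_takel ?ss // big_mkord.
  rewrite [RHS]big_mkcond.
  by apply: eq_bigr => k _; rewrite nth_take // /at_; case: (_ \in _).
by rewrite -[in X in _ <= X](cat_take_drop t s) count_cat leq_addr.
Qed.

(** Dividing the multiplicity of each cover by [N] and rounding down loses less
    than one unit for each of the at most [#|{set T}|] distinct covers. *)
Lemma pow_exponent_scale E t a N M :
    0 < N -> N * (t + #|{set T}|) <= M ->
    pow_exponent E M (fun x => N * a x) -> pow_exponent E t a.
Proof.
move=> N0 NM [C [covC Ca]].
pose n A := #|[set k | C k == A]|.
have nM : \sum_A n A = M.
  rewrite -[RHS]card_ord -sum1_card (partition_big C xpredT) //=.
  apply: eq_bigr => A _; rewrite /n -sum1_card.
  by apply: eq_bigl => k; rewrite inE.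
apply: (@pow_exponent_mult E t a (fun A => n A %/ N)).
- move=> A qA; have : 0 < n A by case: (n A) qA; rewrite ?div0n.
  by move=> /card_gt0P[k]; rewrite inE => /eqP <-.
- rewrite -(leq_pmul2l N0) big_distrr /= -(leq_add2r (N * #|{set T}|)) -mulnDr.
  apply: leq_trans NM _; rewrite -nM.
  rewrite (mulnC N) -sum_nat_const -big_split /=; apply: leq_sum => A _.
  rewrite [in X in X <= _](divn_eq (n A) N) mulnC leq_add2l.
  by rewrite ltnW // ltn_mod.
- move=> x; rewrite -(leq_pmul2l N0); apply: leq_trans (Ca x).
  rewrite big_distrr /=.
  have -> : \sum_k (x \in C k) = \sum_(A : {set T} | x \in A) n A.
    rewrite (eq_bigr (fun k => if x \in C k then 1 else 0)) => [|k _];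
      last by case: (_ \in _).
    rewrite -big_mkcond (partition_big C (fun A => x \in A)) //=.
    apply: eq_bigr => A xA; rewrite /n -sum1_card.
    apply: eq_bigl => k; rewrite inE.
    by case: eqP => [->|]; rewrite ?xA ?andbF.
  by apply: leq_sum => A _; rewrite mulnC leq_divM.
Qed.

(** The [s]-th symbolic power of the cover ideal is not contained in its [t]-th
    power; see [pow_ideal_noncontained]. *)
Definition noncontained E s t : Prop :=
  exists2 a, symb_exponent E s a & ~ pow_exponent E t a.

(** A witness for one graph extends to the clique-sum by the value [s] at the
    other vertices: an edge of the other graph either meets them or lies in the
    clique, hence in the first graph. *)
Lemma noncontained_glue (V1 V2 S : {set T}) E1 E2 s t :
    (forall e, e \in E1 -> e \subset V1) ->
    (forall e, e \in E2 -> e \subset V2) ->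
    V1 :&: V2 = S ->
    (forall e : {set T}, e \subset S -> (e \in E1) = (e \in E2)) ->
    (forall x y, x \in S -> y \in S -> x != y -> [set x; y] \in E1 :&: E2) ->
  noncontained (E1 :|: E2) s t <-> noncontained E1 s t \/ noncontained E2 s t.
Proof.
move=> EV1 EV2 VS SS SE.
have glue a := pow_exponent_glue t a EV1 EV2 VS SE.
split=> [[a sa npa]|].
  apply: contrapT => /not_orP[n1 n2]; apply: npa; apply/glue.
  by split; apply: contrapT => np; [apply: n1|apply: n2]; exists a => // e eE;
    apply: sa; rewrite inE eE ?orbT.
have ext (W1 W2 : {set T}) (F1 F2 : {set {set T}}) :
    (forall e, e \in F1 -> e \subset W1) ->
    (forall e, e \in F2 -> e \subset W2) ->
    W1 :&: W2 = S ->
    (forall e : {set T}, e \subset S -> e \in F2 -> e \in F1) ->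
    (forall a, pow_exponent (E1 :|: E2) t a -> pow_exponent F1 t a) ->
    F1 :|: F2 = E1 :|: E2 ->
    noncontained F1 s t -> noncontained (E1 :|: E2) s t.
  move=> FW1 FW2 WS FS pF FE [a sa npa].
  exists (fun x => if x \in W1 then a x else s); last first.
    by move=> /pF pa; apply: npa; apply: pow_exponent_le FW1 _ pa => x ->.
  rewrite -FE => e.
  have sF1 : symb_exponent F1 s (fun x => if x \in W1 then a x else s).
    by apply: symb_exponent_le FW1 _ sa => x ->.
  move=> /setUP[/sF1//|eF2].
  have [eW1|] := boolP (e \subset W1).
    by apply: sF1; apply: FS => //; rewrite -WS finset.subsetI eW1 FW2.
  move=> /subsetPn[x xe xW1]; rewrite (bigD1 x) //= (negPf xW1).
  exact: leq_addr.
case; [apply: (ext V1 V2 E1 E2)|apply: (ext V2 V1 E2 E1)] => //.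
- by move=> e /SS ->.
- by move=> a /glue[].
- by rewrite finset.setIC.
- by move=> e /SS ->.
- by move=> a /glue[].
- by rewrite finset.setUC.
Qed.
(** Suppose containment held at [(s' k, t' k)] for arbitrarily large [k].  If
    [a] has all edge sums at least [s r], then [N a], with [N] about
    [s' k / (s r)], has edge sums at least [s' k], so it dominates [t' k]
    covers, and by [pow_exponent_scale] [a] dominates about
    [t' k / N - c], that is [t' s r / s' - c] covers.  This exceeds [t r] once
    [r] is large, since [t' s > t s']: containment holds at [(s r, t r)]. *)
Lemma noncontained_asymp E s t s' t' :
    (0 < s) -> (s' * t < s * t') ->
    (forall r0, exists2 r, (r0 <= r) & noncontained E (s * r) (t * r)) ->
  exists k0, forall k, (k0 <= k) -> noncontained E (s' * k) (t' * k).
Proof.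
move=> s0 st infr; pose c := #|{set T}|.
have [r rc [a sa npa]] := infr (s' * c).+1.
(* the bound on k makes N (t r + c) <= t' k, given that r > s' c *)
exists (s * r * (t * r + c)) => k kbig.
apply: contrapT => ncont; apply: npa.
have r0 : (0 < r) by exact: leq_ltn_trans rc.
have sr0 : (0 < s * r) by rewrite muln_gt0 s0.
pose N := ((s' * k) %/ (s * r)).+1.
have skN : (s' * k <= N * (s * r)) by rewrite ltnW // ltn_ceil.
have Nsk : (N * (s * r) <= s' * k + s * r).
  by rewrite mulSn addnC leq_add2r leq_divM.
apply: (@pow_exponent_scale _ _ _ N (t' * k)) => //.
- rewrite -(leq_pmul2r sr0) mulnAC.
  apply: leq_trans (leq_mul Nsk (leqnn _)) _.
  rewrite mulnDl.
  have gap : (s' * (t * r + c) < s * r * t').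
    have : (s' * t * r + r <= s * t' * r).
      by rewrite -mulSnr leq_mul2r st orbT.
    move: rc; rewrite mulnDr mulnA (mulnAC s r); lia.
  have := leq_mul (leqnn k) gap; rewrite mulnS.
  move: kbig; rewrite (mulnC s' k) -(mulnA k) (mulnC (s * r) t').
  by rewrite (mulnAC t' k) (mulnC _ k); lia.
- apply: contrapT => npa; apply: ncont; exists (fun x => (N * a x)) => // e eE.
  rewrite -big_distrr /=; apply: leq_trans skN _.
  by rewrite leq_mul2l sa.
Qed.

End Exponents.

Local Open Scope classical_set_scope.
Local Open Scope ring_scope.

(** * Suprema of ratios *)

Section Sup.
Variable R : realType.
Implicit Types P : nat -> nat -> Prop.

Definition ratio_sup P : \bar R :=
  ereal_sup [set x | exists s t : nat,
    [/\ (0 < s)%N, (0 < t)%N, x = (s%:R / t%:R)%:E & P s t]].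

Definition asymptotic P : nat -> nat -> Prop :=
  fun s t => \forall r \near \oo, P (s * r)%N (t * r)%N.

Lemma ratio_sup_ub P (s t : nat) : (0 < s)%N -> (0 < t)%N -> P s t ->
  ((s%:R / t%:R)%:E <= ratio_sup P)%E.
Proof. by move=> s0 t0 Pst; apply: ereal_sup_ubound; exists s, t. Qed.

Lemma ratio_sup_le P (x : \bar R) :
    (forall s t, (0 < s)%N -> (0 < t)%N -> P s t ->
       ((s%:R / t%:R)%:E <= x)%E) ->
  (ratio_sup P <= x)%E.
Proof.
by move=> Px; apply: ge_ereal_sup => _ [s [t [s0 t0 -> Pst]]]; apply: Px.
Qed.

Lemma ratio_sup_or P P1 P2 : (forall s t, P s t <-> P1 s t \/ P2 s t) ->
  ratio_sup P = Order.max (ratio_sup P1) (ratio_sup P2).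
Proof.
move=> PE; apply/le_anti/andP; split.
  apply: ratio_sup_le => s t s0 t0 /PE[]/(ratio_sup_ub s0 t0) le_s;
  by rewrite le_max le_s ?orbT.
by rewrite ge_max; apply/andP; split; apply: ratio_sup_le => s t s0 t0 Pst;
  apply: ratio_sup_ub => //; apply/PE; [left|right].
Qed.

(** The ratios [(s m - 1) / (t m)] increase to [s / t]. *)
Lemma le_ratio_sup P (s t : nat) : (0 < s)%N -> (0 < t)%N ->
    (forall s' t', (0 < s')%N -> (0 < t')%N -> (s' * t < s * t')%N ->
       P s' t') ->
  ((s%:R / t%:R)%:E <= ratio_sup P)%E.
Proof.
move=> s0 t0 Pst; apply/lee_addgt0Pr => e e0.
(* at least 2, so that s m - 1 is positive, and 1 / (t m) <= e *)
pose m := (Num.bound e^-1).+2.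
have sm0 : (0 < (s * m).-1)%N.
  by rewrite /m mulnS -ltnS prednK; lia.
have tm0 : (0 < t * m)%N by rewrite muln_gt0 t0.
have le_e : ((t * m)%:R)^-1 <= e :> R.
  rewrite -[leRHS]invrK lef_pV2 ?posrE ?invr_gt0 ?ltr0n //.
  apply: le_trans (ltW (archi_boundP _)) _; first by rewrite invr_ge0 ltW.
  by rewrite ler_nat; rewrite /m; nia.
have -> : s%:R / t%:R = ((s * m).-1)%:R / (t * m)%:R + ((t * m)%:R)^-1 :> R.
  rewrite -[X in _ + X]mul1r -mulrDl -(natrD _ _ 1) addn1 prednK; last by lia.
  by rewrite !natrM -mulf_div divff ?mulr1 // pnatr_eq0.
rewrite EFinD leeD ?lee_fin //; apply: ratio_sup_ub => //; apply: Pst => //.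
by rewrite mulnCA (mulnC t); nia.
Qed.

(** The property of [noncontained E] established in [noncontained_asymp]. *)
Definition spreads P : Prop :=
  forall s t s' t' : nat, (0 < s)%N -> (s' * t < s * t')%N ->
    (forall r0, exists2 r, (r0 <= r)%N & P (s * r)%N (t * r)%N) ->
  exists k0, forall k, (k0 <= k)%N -> P (s' * k)%N (t' * k)%N.

(** If [P] holds along [(s r, t r)] for all large [r], then one of [P1], [P2]
    holds for infinitely many [r]; the spreading hypothesis turns this into
    asymptotic validity at every smaller ratio, enough for the supremum. *)
Lemma asymptotic_ratio_sup_or P P1 P2 :
    (forall s t, P s t <-> P1 s t \/ P2 s t) ->
    spreads P1 -> spreads P2 ->
  ratio_sup (asymptotic P) =
    Order.max (ratio_sup (asymptotic P1)) (ratio_sup (asymptotic P2)).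
Proof.
move=> PE spr1 spr2.
have le_sup Q s t : spreads Q -> (0 < s)%N -> (0 < t)%N ->
    (forall r0, exists2 r, (r0 <= r)%N & Q (s * r)%N (t * r)%N) ->
    ((s%:R / t%:R)%:E <= ratio_sup (asymptotic Q))%E.
  move=> spr s0 t0 infr; apply: le_ratio_sup => // s' t' _ _ st.
  by have [k0 k0P] := spr s t s' t' s0 st infr; exists k0.
apply/le_anti/andP; split.
  apply: ratio_sup_le => s t s0 t0 [n _ nP]; rewrite le_max.
  have [inf1|ninf1] := pselect
      (forall r0, exists2 r, (r0 <= r)%N & P1 (s * r)%N (t * r)%N).
    by rewrite le_sup.
  apply/orP; right; apply: le_sup => // r0.
  have /existsNP[r1 r1P] := ninf1.
  pose r := maxn r0 (maxn r1 n); exists r; first exact: leq_maxl.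
  have nr : (n <= r)%N by rewrite !leq_max leqnn !orbT.
  have /PE[P1r|//] := nP r nr.
  by case: r1P; exists r; rewrite // !leq_max leqnn orbT.
by rewrite ge_max; apply/andP; split; apply: ratio_sup_le => s t s0 t0 [n _ nP];
  apply: ratio_sup_ub => //; exists n => // k /nP; rewrite /= PE; [left|right].
Qed.
End Sup.

(** * Polynomials with prescribed support *)

(** The order of vanishing at [0] of a polynomial over a domain is additive,
    and [q] has order [0]. *)
Lemma coef_lt_cancel (A : idomainType) s (p q : {poly A}) : q`_0 != 0 ->
    (forall k, (k < s)%N -> (p * q)`_k = 0) ->
  forall k, (k < s)%N -> p`_k = 0.
Proof.
move=> q0 pq0; elim/ltn_ind => k IH ks.
have := pq0 k ks; rewrite coefM big_ord_recr /= big1 ?add0r => [|i _].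
  by rewrite subnn => /eqP; rewrite mulf_eq0 (negPf q0) orbF => /eqP.
by rewrite IH ?mul0r //; apply: ltn_trans ks.
Qed.

Section MonomialSets.
Variables (K : fieldType) (n : nat).
Implicit Types (M N : 'X_{1..n} -> Prop) (f g : {mpoly K[n]}) (m : 'X_{1..n}).

(** When [M m] implies [M (m' + m)], this is the monomial ideal spanned by the
    monomials with exponent in [M]. *)
Definition supported M : set {mpoly K[n]} :=
  [set f | forall m, m \in msupp f -> M m].

Lemma supportedX M m : supported M 'X_[m] <-> M m.
Proof.
split=> [|Mm k]; first by apply; rewrite msuppX mem_head.
by rewrite msuppX inE => /eqP ->.
Qed.

Lemma supported0 M : supported M 0.
Proof. by move=> m; rewrite msupp0. Qed.

Lemma supportedD M f g : supported M f -> supported M g -> supported M (f + g).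
Proof. by move=> Mf Mg m /msuppD_le; rewrite mem_cat => /orP[/Mf|/Mg]. Qed.

Lemma supported_sum M (I : Type) (r : seq I) (P : pred I)
    (F : I -> {mpoly K[n]}) :
  (forall i, P i -> supported M (F i)) -> supported M (\sum_(i <- r | P i) F i).
Proof.
by move=> MF; apply: big_ind => //; [exact: supported0|exact: supportedD].
Qed.

Lemma supportedM M1 M2 M f g :
    (forall m1 m2, M1 m1 -> M2 m2 -> M (m1 + m2)%MM) ->
  supported M1 f -> supported M2 g -> supported M (f * g).
Proof.
move=> MM Mf Mg m /msuppM_le /allpairsP[[m1 m2] /= [m1f m2g ->]].
by apply: MM; [apply: Mf|apply: Mg].
Qed.

Lemma supportedZ M c f : supported M f -> supported M (c *: f).
Proof. by move=> Mf m /msuppZ_le /Mf. Qed.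

Lemma supportedT f : supported (fun=> True) f.
Proof. by []. Qed.

Lemma ideal_gen_supported M (U : set {mpoly K[n]}) :
    (forall m m', M m -> M (m' + m)%MM) ->
    U `<=` supported M ->
    (forall m, M m -> exists m1 m2, m = (m1 + m2)%MM /\ U 'X_[m2]) ->
  ideal_gen U = supported M.
Proof.
move=> MD UM MU; apply/seteqP; split=> [_ [k [c [s [_ Us ->]]]]|f Mf].
  apply: supported_sum => i _; apply: supportedM (@supportedT _) (UM _ (Us i)).
  by move=> m1 m2 _; apply: MD.
pose k := size (msupp f).
have /choice[p pP] : forall i : 'I_k, exists p : 'X_{1..n} * 'X_{1..n},
    nth 0%MM (msupp f) i = (p.1 + p.2)%MM /\ U 'X_[p.2].
  move=> i; have [m1 [m2 m12]] := MU _ (Mf _ (mem_nth 0%MM (ltn_ord i))).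
  by exists (m1, m2).
exists k, (fun i : 'I_k => f@_(nth 0%MM (msupp f) i) *: 'X_[(p i).1]),
  (fun i => 'X_[(p i).2]); split=> // [i|]; first by case: (pP i).
rewrite [LHS]mpolyE [LHS](big_nth 0%MM) [LHS]big_mkord; apply: eq_bigr => i _.
by rewrite -scalerAl -mpolyXD -(pP i).1.
Qed.

Variable W : pred 'I_n.

Definition weight m : nat := (\sum_(i < n | W i) m i)%N.

(** Substitutes [u 'X_i] for ['X_i] when [i] is in [W], where [u] is a new
    variable: the coefficient of [u ^ k] is the part of weight [k]. *)
Definition graded : {mpoly K[n]} -> {poly {mpoly K[n]}} :=
  mmap (polyC \o @mpolyC n K) (fun i => ('X_i)%:P * 'X ^+ W i).

Lemma gradedX c m : graded (c *: 'X_[m]) = (c *: 'X_[m])%:P * 'X^(weight m).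
Proof.
rewrite /graded mmapZ mmapX /mmap1 -mul_mpolyC polyCM -mulrA; congr (_ * _).
rewrite (eq_bigr (fun i => ('X_i ^+ m i)%:P * 'X^(W i * m i)));
  last by move=> i _; rewrite exprMn polyC_exp exprM.
rewrite big_split /= -(big_morph polyC (@polyCM _) (@polyC1 _)) -mpolyXE_id.
congr (_ * _); rewrite prodrXr; congr ('X^ _).
rewrite /weight [RHS]big_mkcond; apply: eq_bigr => i _.
by case: (W i); rewrite ?mul1n.
Qed.

Lemma gradedM f g : graded (f * g) = graded f * graded g.
Proof. exact: rmorphM. Qed.

Lemma coef_graded f k m : (graded f)`_k@_m = f@_m *+ (weight m == k).
Proof.
rewrite {1}[f]mpolyE /graded raddf_sum /= -/graded coef_sum raddf_sum /=.
have term m' : (graded (f@_m' *: 'X_[m']))`_k@_m =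
    (f@_m' *+ (m' == m)) *+ (weight m' == k).
  rewrite gradedX coefMXn; case: ltnP => wk.
    by rewrite mcoeff0 (gtn_eqF wk) mulr0n.
  rewrite coefC subn_eq0 [in RHS]eqn_leq wk /=.
  case: (k <= _)%N; last by rewrite mcoeff0 mulr0n.
  by rewrite mcoeffZ mcoeffX mulr_natr mulr1n.
rewrite (eq_bigr _ (fun m' _ => term m')).
have [mf|mf] := boolP (m \in msupp f).
  rewrite (bigD1_seq m) ?msupp_uniq //= eqxx mulr1n.
  rewrite big1 ?addr0 // => m' /negPf ->.
  by rewrite mulr0n mul0rn.
rewrite (memN_msupp_eq0 mf) mul0rn big_seq big1 // => m' m'f.
case: eqP => [m'm|_]; last by rewrite mulr0n mul0rn.
by rewrite -m'm m'f in mf.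
Qed.

Lemma supported_weightP s f :
  supported (fun m => (s <= weight m)%N) f <->
  forall k, (k < s)%N -> (graded f)`_k = 0.
Proof.
split=> [sf k ks|f0 m mf].
  apply/mpolyP => m; rewrite coef_graded mcoeff0; case: eqP => [wm|//].
  have [/sf|/memN_msupp_eq0->] := boolP (m \in msupp f); last by rewrite mul0rn.
  by rewrite wm leqNgt ks.
rewrite leqNgt; apply/negP => /f0 /(congr1 (mcoeff m)).
by rewrite coef_graded eqxx mulr1n mcoeff0 => /eqP; rewrite mcoeff_eq0 mf.
Qed.

(** The polynomials all of whose terms have weight at least [s] form the [s]-th
    power of the prime generated by the variables in [W]; the lemma says that it
    is primary.  The smallest weight of a term is additive because it is the
    order of vanishing of [graded f] at [u = 0]. *)
Lemma supported_weight_cancel s f g :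
    ~ supported (fun m => (1 <= weight m)%N) g ->
    supported (fun m => (s <= weight m)%N) (f * g) ->
  supported (fun m => (s <= weight m)%N) f.
Proof.
move=> /supported_weightP g0 /supported_weightP fg0.
apply/supported_weightP/(@coef_lt_cancel _ s _ (graded g)).
  by apply/eqP => g00; apply: g0 => -[].
by move=> k /fg0; rewrite gradedM.
Qed.

Lemma supported_weight_prime :
  prime_ideal (supported (fun m => (1 <= weight m)%N)).
Proof.
split; [split|].
- by rewrite inE; apply: supported0.
- rewrite notin_setE; move=> /(_ 0%MM); rewrite msupp1 mem_head => /(_ isT).
  by rewrite /weight big1 // => i _; rewrite mnm0E.
- move=> a u v; rewrite !inE => Pu Pv; apply: supportedD => //.
  apply: supportedM (@supportedT _) Pu => m1 m2 _ wm2; apply: leq_trans wm2 _.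
  by apply: leq_sum => i _; rewrite mnmDE leq_addl.
move=> u v; rewrite inE => Puv.
have [Pv|nPv] := pselect (supported (fun m => (1 <= weight m)%N) v).
  by apply/orP; right; rewrite inE.
by apply/orP; left; rewrite inE; apply: supported_weight_cancel nPv Puv.
Qed.

End MonomialSets.

(** * Powers and symbolic powers of cover ideals *)

Section Localization.
Variable A : idomainType.
Implicit Types (I P : set A).

(** Reduction to a common denominator, which stays outside [P] as [P] is
    prime. *)
Lemma local_extP I P f : prime_ideal P ->
    (forall g h, I g -> I h -> I (g + h)) ->
    (forall a g, I g -> I (a * g)) -> I 0 ->
  local_ext I P (tofrac f) <-> exists2 b, ~ P b & I (b * f).
Proof.
move=> [[P0 P1 PD] Pprime] ID IM I0.
have bN0 b : ~ P b -> b != 0.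
  by move=> Pb; apply/eqP => b0; apply: Pb; rewrite b0; move: P0; rewrite inE.
split=> [[n [c [s [cP sI fE]]]]|[b Pb Ibf]]; last first.
  exists 1%N, (fun=> tofrac 1 / tofrac b), (fun=> tofrac (b * f)).
  split=> [_|_|].
  - by exists 1, b.
  - by exists (b * f).
  rewrite big_ord1 tofracM tofrac1 mul1r mulKf // tofrac_eq0; exact: bN0.
suff [b Pb [g Ig gE]] : exists2 b, ~ P b & exists2 g, I g &
    (\sum_(i < n) c i * s i) * tofrac b = tofrac g.
  exists b => //; suff -> : b * f = g by [].
  by apply/eqP; rewrite -tofrac_eq tofracM mulrC fE gE.
elim: n c s cP sI {fE} => [|n IHn] c s cP sI.
  exists 1; first by move: P1; rewrite notin_setE.
  by exists 0; rewrite ?big_ord0 ?mul0r ?tofrac0.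
have [||b Pb [g Ig gE]] := IHn (fun i => c (widen_ord (leqnSn n) i))
  (fun i => s (widen_ord (leqnSn n) i)) => //.
have [a [d [Pd cE]]] := cP ord_max; have [h Ih hE] := sI ord_max.
exists (b * d).
  by move=> Pbd; have := Pprime b d; rewrite !inE => /(_ Pbd) /orP[];
    rewrite inE.
exists (g * d + b * a * h); first by apply: ID; [rewrite mulrC|]; apply: IM.
rewrite big_ord_recr /= mulrDl tofracD !tofracM mulrA gE; congr (_ + _).
rewrite cE -hE; have : tofrac d != 0 by rewrite tofrac_eq0 bN0.
by move=> d0; field.
Qed.
End Localization.

Section VertexSets.
Variables (K : fieldType) (T : finType).
Implicit Types (V W C : {set T}) (E : {set {set T}}) (a : T -> nat).

(** The exponent vector on [T] of a monomial in the variables indexed by [V],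
    zero outside [V].  It makes monomials over different vertex sets
    comparable. *)
Definition expo V (m : 'X_{1..#|V|}) (x : T) : nat :=
  (\sum_(i < #|V| | enum_val i == x) m i)%N.

Definition mon_of V a : 'X_{1..#|V|} := [multinom a (enum_val i) | i < #|V|].

Lemma expoD V (m m' : 'X_{1..#|V|}) x :
  expo (m + m')%MM x = (expo m x + expo m' x)%N.
Proof. by rewrite /expo -big_split; apply: eq_bigr => i _; rewrite mnmDE. Qed.

Lemma expo_val V (m : 'X_{1..#|V|}) i : expo m (enum_val i) = m i.
Proof.
by rewrite /expo (big_pred1 i) // => j; rewrite /= (inj_eq enum_val_inj).
Qed.

Lemma expo_mon_of V a x : x \in V -> expo (mon_of V a) x = a x.
Proof. by move=> xV; rewrite -(enum_rankK_in xV xV) expo_val mnmE. Qed.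

Lemma expoN V (m : 'X_{1..#|V|}) x : x \notin V -> expo m x = 0%N.
Proof.
by move=> xV; rewrite /expo big1 // => i /eqP ix; rewrite -ix enum_valP in xV.
Qed.

Lemma expo_weight V (m : 'X_{1..#|V|}) (e : {set T}) :
  (\sum_(x in e) expo m x = weight (fun i => enum_val i \in e) m)%N.
Proof.
rewrite /expo (exchange_big_dep (fun i => enum_val i \in e)) /=.
  apply: eq_bigr => i ie; rewrite (big_pred1 (enum_val i)) // => x.
  by rewrite /= eq_sym andb_idl // => /eqP->.
by move=> x i xe /eqP ->.
Qed.

(** For [t = 1] this is the cover ideal of the graph with edges [E], extended to
    the variables indexed by [V], see [cover_idealE] and
    [ideal_ext_pow_ideal]. *)
Definition pow_ideal V E t : set {mpoly K[#|V|]} :=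
  supported (fun m => pow_exponent E t (expo m)).
Definition symb_ideal V E s : set {mpoly K[#|V|]} :=
  supported (fun m => symb_exponent E s (expo m)).
Arguments pow_ideal V E t _ : clear implicits.
Arguments symb_ideal V E s _ : clear implicits.


Lemma pow_exponent_factor V E t (m : 'X_{1..#|V|}) :
    (forall e, e \in E -> e \subset V) -> pow_exponent E t (expo m) ->
  exists (C : 'I_t -> {set T}) (m' : 'X_{1..#|V|}),
    (forall k, covers E (C k) /\ C k \subset V) /\
    m = (m' + \sum_k mon_of V (fun x => x \in C k))%MM.
Proof.
move=> EV [C [covC Cm]]; pose D k := (C k :&: V)%SET.
exists D, (m - \sum_k mon_of V (fun x => x \in D k))%MM; split=> [k|].
  split=> [e eE|]; last exact: finset.subsetIr.
  have [x xe xC] := covC k e eE.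
  by exists x => //; rewrite finset.inE xC (fintype.subsetP (EV e eE)).
rewrite submK //; apply/mnm_lepP => i; rewrite mnm_sumE -expo_val.
apply: leq_trans (Cm _); apply: leq_sum => k _.
by rewrite mnmE finset.inE enum_valP andbT.
Qed.

Lemma pow_exponent_cover V E C :
  covers E C -> (forall e, e \in E -> e \subset V) ->
  pow_exponent E 1 (expo (mon_of V (fun x => x \in C))).
Proof.
move=> covC EV; apply: (@pow_exponent_le _ E V _ (fun x => x \in C)) => //.
  by move=> x xV; rewrite expo_mon_of.
by exists (fun=> C); split=> // x; rewrite big_ord1.
Qed.

Lemma pow_exponent_expoD V E t (m m' : 'X_{1..#|V|}) :
  pow_exponent E t (expo m) -> pow_exponent E t (expo (m' + m)%MM).
Proof. by apply: pow_exponent_mono => x; rewrite expoD leq_addl. Qed.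

Lemma pow_ideal_prod V E t (g : 'I_t -> {mpoly K[#|V|]}) :
  (forall k, pow_ideal V E 1 (g k)) -> pow_ideal V E t (\prod_k g k).
Proof.
elim: t g => [|t IHt] g gI; first by move=> m _; apply: pow_exponent0.
rewrite big_ord_recl; apply: supportedM (gI _) (IHt _ (fun k => gI _)).
move=> m1 m2 pm1 pm2; rewrite -add1n.
by apply: pow_exponent_mono (pow_exponentD pm1 pm2) => x; rewrite expoD.
Qed.

Lemma ideal_pow_pow_ideal V E t : (forall e, e \in E -> e \subset V) ->
  ideal_pow (pow_ideal V E 1) t = pow_ideal V E t.
Proof.
move=> EV; apply: ideal_gen_supported => [m m'|f [g [gI ->]]|m].
- exact: pow_exponent_expoD.
- exact: pow_ideal_prod.
move=> /(pow_exponent_factor EV)[C [m' [CP ->]]].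
exists m', (\sum_k mon_of V (fun x => x \in C k))%MM; split=> //.
exists (fun k => 'X_[mon_of V (fun x => x \in C k)]); split=> [k|].
  by apply/supportedX/pow_exponent_cover => //; case: (CP k).
by rewrite -(big_map (fun k => mon_of V (fun x => x \in C k)) xpredT
  (fun m => 'X_[m])) mpolyX_prod big_map.
Qed.

(** The ideal generated by the variables at the vertices of [e]. *)
Definition edge_prime V (e : {set T}) : set {mpoly K[#|V|]} :=
  supported (fun m => (1 <= \sum_(x in e) expo m x)%N).
Arguments edge_prime V e _ : clear implicits.

Lemma supported_edge V (e : {set T}) s :
  supported (fun m => (s <= \sum_(x in e) expo m x)%N) =
  supported (fun m => (s <= weight (fun i => enum_val i \in e) m)%N)
    :> set {mpoly K[#|V|]}.
Proof. by congr supported; apply/funext => m; rewrite expo_weight. Qed.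

Lemma edge_prime_prime V e : prime_ideal (edge_prime V e).
Proof.
by rewrite /edge_prime supported_edge; apply: supported_weight_prime.
Qed.

Lemma edge_prime_cancel V (e : {set T}) s (f b : {mpoly K[#|V|]}) :
    ~ edge_prime V e b ->
    supported (fun m => (s <= \sum_(x in e) expo m x)%N) (f * b) ->
  supported (fun m => (s <= \sum_(x in e) expo m x)%N) f.
Proof.
by rewrite /edge_prime !supported_edge; apply: supported_weight_cancel.
Qed.

(** The [s]-th power of the product of the variables away from [e].  It is a
    unit in the localization at [edge_prime V e], and multiplying by it makes
    the conditions on all other edges hold, so it serves both to realize
    [edge_prime V e] as a colon ideal and as a denominator. *)
Definition off_edge V (e : {set T}) s : {mpoly K[#|V|]} :=
  'X_[mon_of V (fun x => s * (x \notin e))%N].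
Arguments off_edge V e s : clear implicits.

Lemma off_edgeN V e s : ~ edge_prime V e (off_edge V e s).
Proof.
move=> /supportedX; rewrite lt0n sum_nat_eq0 => /forall_inPn[x xe].
have [xV|xV] := boolP (x \in V); last by rewrite expoN.
by rewrite expo_mon_of // xe muln0.
Qed.

Lemma off_edgeP V E (e : {set T}) s (f : {mpoly K[#|V|]}) :
    (forall e', e' \in E -> #|e'| = 2) ->
    (forall e', e' \in E -> e' \subset V) ->
    #|e| = 2 -> e \subset V ->
    supported (fun m => (s <= \sum_(x in e) expo m x)%N) f ->
  pow_ideal V E s (f * off_edge V e s).
Proof.
move=> E2 EV e2 eV sf.
have off : supported (eq (mon_of V (fun x => s * (x \notin e))%N))
    (off_edge V e s) by apply/supportedX.
apply: supportedM sf off.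
move=> m _ sm <-.
apply: (@pow_exponent_le _ E V _
  (fun x => expo m x + s * (x \notin e))%N) => //.
  by move=> x xV; rewrite expoD expo_mon_of.
apply: (pow_exponent_edge E2 e2) => [|x xe]; last by rewrite xe muln1 leq_addl.
by apply: leq_trans sm _; apply: leq_sum => x _; apply: leq_addr.
Qed.

Lemma pow_ideal_edge V E e t : e \in E ->
  pow_ideal V E t `<=` supported (fun m => (t <= \sum_(x in e) expo m x)%N).
Proof. by move=> eE f pf m /pf /pow_symb_exponent; apply. Qed.

Lemma edge_prime_assoc V E e :
    (forall e', e' \in E -> #|e'| = 2) ->
    (forall e', e' \in E -> e' \subset V) ->
    e \in E ->
  assoc_primes (pow_ideal V E 1) (edge_prime V e).
Proof.
move=> E2 EV eE; split; first exact: edge_prime_prime.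
exists (off_edge V e 1); apply/seteqP; split=> f /= fe.
  by apply: off_edgeP; auto.
exact: edge_prime_cancel (@off_edgeN V e 1) (pow_ideal_edge eE fe).
Qed.

(** If [P] is the colon ideal of [g], then [g] is not in the cover ideal, so it
    lies outside the prime of some edge, and that prime contains [P].  The
    inclusion lets a denominator for the edge prime serve for [P]. *)
Lemma assoc_prime_edge V E P : assoc_primes (pow_ideal V E 1) P ->
  exists2 e, e \in E & P `<=` edge_prime V e.
Proof.
move=> [[[_ P1 _] _] [g PE]].
have [e eE ge] : exists2 e, e \in E & ~ edge_prime V e g.
  apply: contrapT => Ng; move: P1; rewrite notin_setE; apply.
  rewrite PE /= mul1r.
  move=> m mg; apply: symb_pow_exponent1 => e eE; apply: contrapT => em.
  by apply: Ng; exists e => // /(_ m mg).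
exists e => // f; rewrite PE /= => fg.
exact: edge_prime_cancel ge (pow_ideal_edge eE fg).
Qed.

(** Localizing at an edge prime keeps exactly the condition on that edge: one
    direction is primariness of its powers, the other is [off_edgeP]. *)
Lemma symb_pow_pow_ideal V E s :
    (forall e, e \in E -> #|e| = 2) -> (forall e, e \in E -> e \subset V) ->
  symb_pow (pow_ideal V E 1) s = symb_ideal V E s.
Proof.
move=> E2 EV; rewrite /symb_pow ideal_pow_pow_ideal //.
have locP P f : prime_ideal P ->
    local_ext (pow_ideal V E s) P (tofrac f) <->
    exists2 b, ~ P b & pow_ideal V E s (b * f).
  move=> Pp; apply: local_extP => //; [exact: supportedD| |exact: supported0].
  move=> a g; apply: supportedM (@supportedT _ _ a) => m1 m2 _.
  exact: pow_exponent_expoD.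
apply/seteqP; split=> f.
  move=> fP m mf e eE.
  have /locP[|b nPb] := fP _ (edge_prime_assoc E2 EV eE).
    exact: edge_prime_prime.
  by rewrite mulrC => /(pow_ideal_edge eE) /(edge_prime_cancel nPb); apply.
move=> sf P aP; apply/locP; first by case: aP.
have [e eE Pe] := assoc_prime_edge aP.
exists (off_edge V e s); first by move=> /Pe; apply: off_edgeN.
by rewrite mulrC; apply: off_edgeP; auto => m /sf; apply.
Qed.

Lemma pow_ideal_noncontained V E s t : (forall e, e \in E -> e \subset V) ->
  ~ (symb_ideal V E s `<=` pow_ideal V E t) <-> noncontained E s t.
Proof.
move=> EV; split=> [nc|[a sa npa] sub].
  apply: contrapT => NE; apply: nc => f sf m mf; apply: contrapT => np.
  by apply: NE; exists (expo m); [apply: sf|].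
apply: npa; apply: (@pow_exponent_le _ E V _ (expo (mon_of V a))) => //.
  by move=> x xV; rewrite expo_mon_of.
suff /supportedX : pow_ideal V E t 'X_[mon_of V a] by [].
apply: sub; apply/supportedX.
by apply: (symb_exponent_le EV _ sa) => x xV; rewrite expo_mon_of.
Qed.

Lemma edges_card (G : graph T) e : e \in edges G -> #|e| = 2.
Proof. by move=> /(forall_inP (edgesP G)) /andP[/eqP]. Qed.

Lemma edges_subset (G : graph T) e : e \in edges G -> e \subset verts G.
Proof. by move=> /(forall_inP (edgesP G)) /andP[]. Qed.

(** * Cover ideals, their extensions and their resurgences *)

Lemma cover_idealE (G : graph T) :
  cover_ideal K G = pow_ideal (verts G) (edges G) 1.
Proof.
have EV := @edges_subset G.
have monE C : \prod_(i < #|verts G| | enum_val i \in C) vvar K i =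
    'X_[mon_of (verts G) (fun x => x \in C)].
  rewrite mpolyXE_id [LHS]big_mkcond; apply: eq_bigr => i _.
  by rewrite mnmE; case: (_ \in C).
apply: ideal_gen_supported => [m m'|f [C [[CV covC] ->]]|m].
- exact: pow_exponent_expoD.
- by rewrite monE; apply/supportedX/pow_exponent_cover.
move=> /(pow_exponent_factor EV)[C [m' [CP ->]]].
exists m', (mon_of (verts G) (fun x => x \in C ord0)).
rewrite big_ord1; split=> //.
by exists (C ord0); rewrite monE; split=> //; split; case: (CP ord0).
Qed.

Lemma vinclX V W (VW : V \subset W) c (m : 'X_{1..#|V|}) :
  vincl VW (c *: 'X_[m] : {mpoly K[#|V|]}) = c *: 'X_[mon_of W (expo m)].
Proof.
rewrite /vincl comp_mpolyZ comp_mpolyX; congr (_ *: _).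
under eq_bigr do rewrite tnth_mktuple /vvar mpolyXn.
rewrite -(big_map _ xpredT (fun m => 'X_[m])) mpolyX_prod big_map; congr 'X_[_].
apply/mnmP => j; rewrite mnm_sumE mnmE /expo [RHS]big_mkcond.
apply: eq_bigr => i _; rewrite mulmnE mnm1E -(inj_eq enum_val_inj).
rewrite enum_rankK_in ?(fintype.subsetP VW) ?enum_valP //.
by case: eqP; rewrite ?mul1n ?muln1 ?mul0n ?muln0.
Qed.

Lemma ideal_ext_pow_ideal V W (VW : V \subset W) E :
    (forall e, e \in E -> e \subset V) ->
  ideal_ext VW (pow_ideal V E 1) = pow_ideal W E 1.
Proof.
move=> EV; have EW e : e \in E -> e \subset W.
  by move=> /EV eV; apply: fintype.subset_trans VW.
have expoW (m : 'X_{1..#|V|}) x : expo (mon_of W (expo m)) x = expo m x.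
  have [xW|xW] := boolP (x \in W); first by rewrite expo_mon_of.
  by rewrite !expoN //; apply: contra xW; apply: (fintype.subsetP VW).
apply: ideal_gen_supported => [m m'|_ [f fI <-]|m].
- exact: pow_exponent_expoD.
- rewrite [f]mpolyE /vincl raddf_sum /= big_seq; apply: supported_sum => m mf.
  rewrite -/(vincl VW _) vinclX; apply: supportedZ; apply/supportedX.
  by apply: pow_exponent_mono (fI m mf) => x; rewrite expoW.
move=> /(pow_exponent_factor EW)[C [m' [CP ->]]].
pose C1 := (C ord0 :&: V)%SET; pose m1 := mon_of V (fun x => x \in C1).
have mE : (mon_of W (expo m1) <= mon_of W (fun x => x \in C ord0))%MM.
  apply/mnm_lepP => i; rewrite !mnmE.
  have [iV|iV] := boolP (enum_val i \in V); last by rewrite expoN.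
  by rewrite expo_mon_of // finset.inE iV andbT.
exists (m' + (mon_of W (fun x => x \in C ord0) - mon_of W (expo m1)))%MM,
  (mon_of W (expo m1)).
rewrite big_ord1 -addmA submK //; split=> //.
exists 'X_[m1]; last by rewrite -[X in vincl _ X]scale1r vinclX scale1r.
apply/supportedX/pow_exponent_cover => // e eE.
have [x xe xC] := (CP ord0).1 e eE.
by exists x; rewrite // finset.inE xC (fintype.subsetP (EV e eE)).
Qed.

End VertexSets.

Arguments pow_ideal K {T} V E t _.

(** In particular, the resurgences do not depend on the ambient variables. *)
Section Resurgence.
Variables (R : realType) (K : fieldType) (T : finType).
Variables (V : {set T}) (E : {set {set T}}).
Hypothesis E2 : forall e, e \in E -> #|e| = 2.
Hypothesis EV : forall e, e \in E -> e \subset V.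

Lemma pow_ideal_noncontainmentE :
  (fun s t => ~ (symb_pow (pow_ideal K V E 1) s `<=`
                 ideal_pow (pow_ideal K V E 1) t)) = noncontained E.
Proof.
apply/funext => s; apply/funext => t; apply/propext.
by rewrite symb_pow_pow_ideal // ideal_pow_pow_ideal //;
  apply: pow_ideal_noncontained.
Qed.

Lemma resurgence_pow_ideal :
  resurgence R (pow_ideal K V E 1) = ratio_sup R (noncontained E).
Proof. by rewrite -pow_ideal_noncontainmentE. Qed.

Lemma asymp_resurgence_pow_ideal :
  asymp_resurgence R (pow_ideal K V E 1) =
    ratio_sup R (asymptotic (noncontained E)).
Proof. by rewrite -pow_ideal_noncontainmentE. Qed.

End Resurgence.

Theorem theorem1p3 (R : realType) (K : fieldType) (T : finType)
  (G1 G2 : graph T)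
  (iso1 : no_isolated G1) (iso2 : no_isolated G2)
  (sumG : clique_sum G1 G2) :
  let G := gunion G1 G2 in
  let J := cover_ideal K G in
  let J1 := cover_ideal K G1 in
  let J2 := cover_ideal K G2 in
  let J1G := ideal_ext (finset.subsetUl (verts G1) (verts G2)) J1 in
  let J2G := ideal_ext (finset.subsetUr (verts G1) (verts G2)) J2 in
  [/\ forall t : nat, (1 <= t)%N ->
        ideal_pow J t = ideal_pow J1G t `&` ideal_pow J2G t,
      forall s : nat, (1 <= s)%N ->
        symb_pow J s = symb_pow J1G s `&` symb_pow J2G s,
      resurgence R J = Order.max (resurgence R J1) (resurgence R J2)
    & asymp_resurgence R J
        = Order.max (asymp_resurgence R J1) (asymp_resurgence R J2)].
Proof.
move=> G J J1 J2 J1G J2G; case: sumG => S [_ interS _ _].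
have VS : (verts G1 :&: verts G2)%SET = S by have := congr1 (@verts T) interS.
have ES e : (e \in edges G1 :&: edges G2)%SET = (e \subset S) && (#|e| == 2).
  by rewrite (congr1 (fun H => e \in edges H) interS) finset.inE.
have SS (e : {set T}) : e \subset S -> (e \in edges G1) = (e \in edges G2).
  move=> eS; have both : #|e| = 2 -> e \in edges G1 /\ e \in edges G2.
    by move=> e2; apply/setIP; rewrite ES eS e2.
  by apply/idP/idP => /[dup] /edges_card /both[].
have SE x y : x \in S -> y \in S -> x != y ->
    ([set x; y] \in edges G1 :&: edges G2)%SET.
  move=> xS yS xy; rewrite ES cards2 xy andbT.
  by apply/fintype.subsetP => z; rewrite !finset.inE => /orP[]/eqP->.
have EV1 := @edges_subset _ G1; have EV2 := @edges_subset _ G2.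
have E21 := @edges_card _ G1; have E22 := @edges_card _ G2.
have EV := @edges_subset _ G; have E2 := @edges_card _ G.
have EV1G e : e \in edges G1 -> e \subset verts G.
  by move=> eE; apply: EV; rewrite finset.inE eE.
have EV2G e : e \in edges G2 -> e \subset verts G.
  by move=> eE; apply: EV; rewrite finset.inE eE orbT.
have JE : J = pow_ideal K (verts G) (edges G) 1 by exact: cover_idealE.
have J1E : J1 = pow_ideal K (verts G1) (edges G1) 1 by exact: cover_idealE.
have J2E : J2 = pow_ideal K (verts G2) (edges G2) 1 by exact: cover_idealE.
have J1GE : J1G = pow_ideal K (verts G) (edges G1) 1.
  by rewrite /J1G J1E ideal_ext_pow_ideal.
have J2GE : J2G = pow_ideal K (verts G) (edges G2) 1.
  by rewrite /J2G J2E ideal_ext_pow_ideal.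
have nonE s t := noncontained_glue s t EV1 EV2 VS SS SE.
rewrite J1GE J2GE JE J1E J2E.
split=> [t _|s _||].
- rewrite !ideal_pow_pow_ideal //; apply/seteqP; split=> [f fP|f [f1 f2] m mf].
    by split=> m /fP /(pow_exponent_glue t _ EV1 EV2 VS SE)[].
  apply/(pow_exponent_glue t _ EV1 EV2 VS SE).
  by split; [apply: f1|apply: f2].
- rewrite !symb_pow_pow_ideal //; apply/seteqP; split=> [f fP|f [f1 f2] m mf e].
    by split=> m /fP fm e eE; apply: fm; rewrite finset.inE eE ?orbT.
  by move=> /setUP[]; [apply: f1|apply: f2].
- by rewrite !resurgence_pow_ideal //; apply: ratio_sup_or.
- rewrite !asymp_resurgence_pow_ideal //.
  by apply: asymptotic_ratio_sup_or => // s t s' t'; apply: noncontained_asymp.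
Qed.
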